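(* Let $R$ be a local Noetherian ring of Krull dimension at most one. There exists a positive integer $n$ such that $\mathrm{Mr}\,E\leq n$ for each indecomposable injective $R$-module $E$.
   Context: All rings are commutative with unity and all modules are unital. For a finitely generated module $X$, $\mathrm{gen}\,X$ is its minimal number of generators. The Malcev rank of a module $M$ is $\mathrm{Mr}\,M=\sup\{\mathrm{gen}\,X\mid X\text{ a finitely generated submodule of }M\}$. *)

(* Defs.v *)
From HB Require Import structures.
From mathcomp Require Import all_boot all_order all_algebra.
From mathcomp Require Import boolp classical_sets constructive_ereal.
Set Implicit Arguments.
Unset Strict Implicit.
Unset Printing Implicit Defensive.
Import Order.TTheory GRing.Theory Num.Theory.
Local Open Scope classical_set_scope.
Local Open Scope ring_scope.

(* Supremum, possibly infinite, of a set of natural numbers (-oo if empty). *)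
Definition nat_sup (A : set nat) : \bar int :=
  supremum -oo%E [set n%:Z%:E | n in A].

Section Modules.
Variables (R : comNzRingType) (M : lmodType R).

Definition submodule (N : set M) : Prop := submod_closed [in N].

Definition lspan (s : seq M) : set M :=
  range (fun c : 'I_(size s) -> R => \sum_(i < size s) c i *: s`_i).

Definition finitely_generated (N : set M) : Prop := exists s, N = lspan s.

(* Meaningful for finitely generated N only; it is 0 otherwise. *)
Definition gen (N : set M) : nat :=
  infimum 0%N [set size s | s in [set s | N = lspan s]].

Definition malcev_rank : \bar int :=
  nat_sup [set gen X | X in [set X | submodule X /\ finitely_generated X]].

Definition indecomposable : Prop :=
  (exists x : M, x != 0) /\
  forall N1 N2 : set M, submodule N1 -> submodule N2 ->
    (forall x, exists y z, [/\ N1 y, N2 z & x = y + z]) ->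
    N1 `&` N2 = [set 0] -> N1 = [set 0] \/ N2 = [set 0].

Definition injective_module : Prop :=
  forall (A B : lmodType R) (i : {linear A -> B}) (f : {linear A -> M}),
    injective i -> exists g : {linear B -> M}, forall a, g (i a) = f a.

End Modules.
Arguments malcev_rank {R} M.
Arguments indecomposable {R} M.
Arguments injective_module {R} M.

Section Rings.
Variable R : comNzRingType.

Definition noetherian : Prop :=
  forall I : set R^o, submodule I -> finitely_generated I.

(* Note that [idealr_closed] includes being a proper ideal. *)
Definition prime_ideal (P : set R) : Prop :=
  idealr_closed [in P] /\ prime_idealr_closed [in P].

Definition maximal_ideal (m : set R) : Prop :=
  idealr_closed [in m] /\
  forall J : set R, idealr_closed [in J] -> m `<=` J -> J = m.

Definition local_ring : Prop := exists! m : set R, maximal_ideal m.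

(* A chain P 0 < ... < P k of primes has length k. *)
Definition krull_dim : \bar int :=
  nat_sup [set k | exists P : nat -> set R,
    (forall i, (i <= k)%N -> prime_ideal (P i)) /\
    (forall i, (i < k)%N -> P i `<` P i.+1)].

End Rings.

Lemma nat_sup_leP (A : set nat) (n : nat) :
  (nat_sup A <= n%:Z%:E)%E <-> forall k, A k -> (k <= n)%N.
Proof.
rewrite /nat_sup.
case: (pselect (A !=set0)) => [A0|/nonemptyPn ->]; last first.
  by rewrite image_set0 supremum0; split=> // _; rewrite leNye.
pose B := [set n%:Z%:E | n in A] : set (\bar int).
have supB : supremums B !=set0.
  case: (pselect (ubound A !=set0)) => [/nat_supremums_neq0 [m [mub mleast]]|unb].
    exists m%:Z%:E; split=> [_ [k Ak <-]|y yub].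
      by rewrite lee_fin lez_nat; exact: mub.
    case: y yub => [[y|y]| |] yub; last first.
    - by have [k Ak] := A0; have := yub _ (ex_intro2 _ _ k Ak erefl).
    - exact: leey.
    - by have [k Ak] := A0; have := yub _ (ex_intro2 _ _ k Ak erefl).
    rewrite lee_fin lez_nat; apply: mleast => k Ak.
    by have := yub _ (ex_intro2 _ _ k Ak erefl); rewrite lee_fin lez_nat.
  exists +oo%E; split=> [x _|y yub]; first exact: leey.
  case: y yub => [[y|y]| |] yub //.
  - exfalso; apply: unb; exists y => k Ak.
    by have := yub _ (ex_intro2 _ _ k Ak erefl); rewrite lee_fin lez_nat.
  - by have [k Ak] := A0; have := yub _ (ex_intro2 _ _ k Ak erefl).
  - by have [k Ak] := A0; have := yub _ (ex_intro2 _ _ k Ak erefl).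
split=> [supn k Ak|Ale].
  rewrite -lez_nat -lee_fin (le_trans _ supn)//.
  by apply: (ge_supremum_Nmem _ supB); exists k.
rewrite /supremum ifF; last by apply/negbTE/set0P; have [k Ak] := A0; exists k%:Z%:E, k.
case: xgetP => [y _ [_ yleast]|noub].
  by apply: yleast => _ [k Ak <-]; rewrite lee_fin lez_nat Ale.
by have [x xB] := supB; case: (noub x).
Qed.

Lemma gen_leP (R : comNzRingType) (M : lmodType R) (N : set M) (n : nat) :
  finitely_generated N ->
  (gen N <= n)%N <-> exists s : seq M, (size s <= n)%N /\ N = lspan s.
Proof.
move=> [s0 Ns0]; rewrite /gen; set S := [set size s | s in _].
have exS : exists k, `[<S k>] by exists (size s0); apply/asboolP; exists s0.
case: (ex_minnP exS) => m /asboolP Sm mmin.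
have infm : infimums S m.
  split=> [k Sk|k klb]; first by apply: mmin; apply/asboolP.
  exact: klb.
suff -> : infimum 0%N S = m.
  split=> [mn|[s [sn Ns]]].
    by have [s /= Ns sm] := Sm; exists s; rewrite sm.
  by apply: leq_trans sn; apply: mmin; apply/asboolP; exists s.
rewrite /infimum ifF; last by apply/negbTE/set0P; exists m.
case: xgetP => [k _ [klb kub]|noinf]; last by case: (noinf m).
apply/eqP; rewrite eqn_leq; apply/andP; split; first exact: (klb m Sm).
by apply: kub => j Sj; apply: mmin; apply/asboolP.
Qed.

(* Main.v *)
(* Let X be a finitely generated submodule of an indecomposable injective module
   E. Such an E is uniform: any two nonzero elements have a common nonzero multiple.
   By Noetherian induction on an ideal I killing X, the number of generators of X is
   bounded in terms of I only. If a b lies in I but neither factor does, then a X is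
   killed by I + R b and the kernel of a on X by I + R a, and the two bounds add up.
   There remains the case where I = Q is prime. If Q is the maximal ideal m, then X
   lies in the socle of E, which is simple or zero. Otherwise take x in m outside Q.
   All ideals strictly above Q have finite colength, and gen X is at most the length
   of X / x X, which is bounded by a number depending on Q + R x only: either
   X contains a copy R y of R / Q with X / R y of finite length and no x-torsion, and
   X / x X has the same length as R y / x R y; or X has finite length, and X / x X
   has the length of the kernel of x on X, a submodule of the annihilator of Q + R x
   in E. Lengths are compared through strict chains of submodules. *)
Require Import Defs.
From mathcomp Require Import all_boot all_order all_algebra.
From mathcomp Require Import boolp classical_sets constructive_ereal.
From HB Require Import structures.
Set Implicit Arguments.
Unset Strict Implicit.
Unset Printing Implicit Defensive.
Import Order.TTheory GRing.Theory Num.Theory.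
Local Open Scope classical_set_scope.
Local Open Scope ring_scope.

(** * Submodules, cyclic submodules, colon ideals and spans *)

Section Submodules.
Variables (R : comNzRingType) (M : lmodType R).
Implicit Types (N A B C : set M) (J : set R^o).

Lemma submoduleP N : submodule N <->
  N 0 /\ forall a u v, N u -> N v -> N (a *: u + v).
Proof.
split=> [[N0 Nlin]|[N0 Nlin]]; split.
- by have := N0; rewrite inE.
- by move=> a u v Nu Nv; have := Nlin a u v; rewrite !inE; apply.
- by rewrite inE.
- by move=> a u v; rewrite !inE; apply: Nlin.
Qed.

Lemma submod0 N : submodule N -> N 0.
Proof. by move=> /submoduleP[]. Qed.

Lemma submodZD N a u v : submodule N -> N u -> N v -> N (a *: u + v).
Proof. by move=> /submoduleP[_]; apply. Qed.

Lemma submodD N u v : submodule N -> N u -> N v -> N (u + v).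
Proof. by move=> sN Nu Nv; rewrite -[u]scale1r; exact: submodZD. Qed.

Lemma submodZ N a u : submodule N -> N u -> N (a *: u).
Proof.
by move=> sN Nu; rewrite -[_ *: _]addr0; apply: submodZD => //; exact: submod0.
Qed.

Lemma submodB N u v : submodule N -> N u -> N v -> N (u - v).
Proof.
by move=> sN Nu Nv; rewrite -scaleN1r addrC; exact: submodZD.
Qed.

Lemma submodDl N u v : submodule N -> N v -> N (u + v) -> N u.
Proof. by move=> sN Nv /(submodB sN) /(_ Nv); rewrite addrK. Qed.

Lemma submodule_set0 : submodule [set 0 : M].
Proof. by apply/submoduleP; split=> //= a u v -> ->; rewrite scaler0 addr0. Qed.

Lemma submodule_setT : submodule [set: M].
Proof. exact/submoduleP. Qed.

Lemma submoduleI A B : submodule A -> submodule B -> submodule (A `&` B).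
Proof.
move=> sA sB; apply/submoduleP; split; first by split; exact: submod0.
by move=> a u v [? ?] [? ?]; split; exact: submodZD.
Qed.

Definition smadd A B : set M := [set z | exists u v, [/\ A u, B v & z = u + v]].

Definition cyc (x : M) : set M := range (fun r : R => r *: x).

Definition scaleset (r : R) A : set M := [set r *: u | u in A].

(** The annihilator of the class of [z] in [M / A], expressed without forming the quotient. *)
Definition colon A (z : M) : set R^o := [set r | A ((r : R) *: z)].

Definition killed J : set M := [set z | forall r, J r -> (r : R) *: z = 0].

Lemma submodule_smadd A B : submodule A -> submodule B -> submodule (smadd A B).
Proof.
move=> sA sB; apply/submoduleP; split.
  by exists 0, 0; split; rewrite ?addr0//; exact: submod0.
move=> a _ _ [u [v [Au Bv ->]]] [u' [v' [Au' Bv' ->]]].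
exists (a *: u + u'), (a *: v + v'); split; [exact: submodZD..|].
by rewrite scalerDr addrACA.
Qed.

Lemma submodule_cyc x : submodule (cyc x).
Proof.
apply/submoduleP; split; first by exists 0 => //; rewrite scale0r.
by move=> a _ _ [r _ <-] [s _ <-]; exists (a * r + s) => //; rewrite scalerDl scalerA.
Qed.

Lemma submodule_scaleset r A : submodule A -> submodule (scaleset r A).
Proof.
move=> sA; apply/submoduleP; split.
  by exists 0; [exact: submod0|rewrite scaler0].
move=> a _ _ [u Au <-] [v Av <-]; exists (a *: u + v); first exact: submodZD.
by rewrite scalerDr !scalerA mulrC.
Qed.

Lemma submodule_killed J : submodule (killed J).
Proof.
apply/submoduleP; split=> [r _|a u v Ju Jv r Jr]; first by rewrite scaler0.
by rewrite scalerDr scalerA mulrC -scalerA Ju // Jv // scaler0 addr0.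
Qed.

Lemma cycx x : cyc x x.
Proof. by exists 1 => //; rewrite scale1r. Qed.

Lemma cyc_sub A x : submodule A -> A x -> cyc x `<=` A.
Proof. by move=> sA Ax _ [r _ <-]; exact: submodZ. Qed.

Lemma sub_smaddl A B : submodule B -> A `<=` smadd A B.
Proof. by move=> sB u Au; exists u, 0; split; rewrite ?addr0//; exact: submod0. Qed.

Lemma sub_smaddr A B : submodule A -> B `<=` smadd A B.
Proof. by move=> sB u Au; exists 0, u; split; rewrite ?add0r//; exact: submod0. Qed.

Lemma smadd_sub A B C : submodule C -> A `<=` C -> B `<=` C -> smadd A B `<=` C.
Proof.
by move=> sC AsC BC _ [u [v [Au Bv ->]]]; apply: submodD => //; [exact: AsC|exact: BC].
Qed.

Lemma smadd_cycP A x y : smadd A (cyc x) y <-> exists u r, A u /\ y = u + r *: x.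
Proof.
split=> [[u [_ [Au [r _ <-] ->]]]|[u [r [Au ->]]]]; first by exists u, r.
by exists u, (r *: x); split=> //; exists r.
Qed.

Lemma scaleset_sub r A : submodule A -> scaleset r A `<=` A.
Proof. by move=> sA _ [u Au <-]; exact: submodZ. Qed.

Lemma scaleset0 A : submodule A -> scaleset 0 A = [set 0].
Proof.
move=> sA; apply/seteqP; split=> [_ [u _ <-]|_ ->]; first by rewrite scale0r.
by exists 0; [exact: submod0|rewrite scaler0].
Qed.

Lemma mem_lspan (s : seq M) z : z \in s -> lspan s z.
Proof.
move=> zs; have zi : (index z s < size s)%N by rewrite index_mem.
exists (fun i => (i == Ordinal zi)%:R) => //.
rewrite (bigD1 (Ordinal zi)) //= eqxx scale1r nth_index // big1 ?addr0//.
by move=> i /negbTE ->; rewrite scale0r.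
Qed.

Lemma submodule_lspan (s : seq M) : submodule (lspan s).
Proof.
apply/submoduleP; split.
  by exists (fun=> 0) => //; rewrite big1// => i _; rewrite scale0r.
move=> a _ _ [c _ <-] [d _ <-]; exists (fun i => a * c i + d i) => //.
by rewrite scaler_sumr -big_split /=; apply: eq_bigr => i _; rewrite scalerDl scalerA.
Qed.

Lemma lspan_sub (s : seq M) N :
  submodule N -> (forall z, z \in s -> N z) -> lspan s `<=` N.
Proof.
move=> sN Ns _ [c _ <-]; elim/big_ind: _ => [|u v|i _]; first exact: submod0.
- exact: submodD.
- by apply: submodZ => //; apply: Ns; exact: mem_nth.
Qed.

Lemma lspan_subset (s t : seq M) : {subset s <= t} -> lspan s `<=` lspan t.
Proof.
move=> st; apply: lspan_sub => [|z /st]; [exact: submodule_lspan|exact: mem_lspan].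
Qed.

Lemma lspan_cat (s t : seq M) : lspan (s ++ t) = smadd (lspan s) (lspan t).
Proof.
have [ss st] := (submodule_lspan s, submodule_lspan t).
apply/seteqP; split.
  apply: lspan_sub => [|z]; first exact: submodule_smadd.
  rewrite mem_cat => /orP[]/mem_lspan; [exact: sub_smaddl|exact: sub_smaddr].
apply: smadd_sub; first exact: submodule_lspan.
- by apply: lspan_subset => z; rewrite mem_cat => ->.
- by apply: lspan_subset => z; rewrite mem_cat orbC => ->.
Qed.

Lemma lspan_insert (s t : seq M) a z : lspan (s ++ a :: t) z ->
  exists r w, lspan (s ++ t) w /\ z = r *: a + w.
Proof.
have sub : lspan (s ++ a :: t) `<=` smadd (lspan (s ++ t)) (cyc a).
  have [ss sc] := (submodule_lspan (s ++ t), submodule_cyc a).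
  apply: lspan_sub => [|y]; first exact: submodule_smadd.
  rewrite mem_cat inE orbCA => /orP[/eqP ->|yst].
    by apply: sub_smaddr => //; exact: cycx.
  by apply: sub_smaddl => //; apply: mem_lspan; rewrite mem_cat.
by move=> /sub /smadd_cycP [w [r [? ->]]]; exists r, w; rewrite addrC.
Qed.

End Submodules.

Lemma submodule_colon (R : comNzRingType) (M : lmodType R) (A : set M) (z : M) :
  submodule A -> submodule (colon A z).
Proof.
move=> sA; apply/submoduleP; split; first by rewrite /colon /= scale0r; exact: submod0.
move=> a u v Au Av; rewrite /colon /= scalerDl -scalerA.
exact: submodZD.
Qed.

(** * Length of [B / A] through strict chains of submodules *)

Section Chains.
Variables (R : comNzRingType) (M : lmodType R).
Implicit Types (A B C D : set M).

(** All [n] recorded steps are strict, but the starting inclusion of [A] may be an equality or not.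
    Thus a chain witnesses that [B / A] has length at least [n], and both ends can be widened
    freely. *)
Inductive chain A : set M -> nat -> Prop :=
| chain_nil B : submodule A -> submodule B -> A `<=` B -> chain A B 0%N
| chain_rcons B C n : chain A B n -> submodule C -> B `<` C -> chain A C n.+1.

(** When [A] lies in [B], this says that the quotient [B / A] has length at most [n]. *)
Definition len_le A B n := forall k, chain A B k -> (k <= n)%N.

Lemma chain_submodl A B n : chain A B n -> submodule A.
Proof. by elim. Qed.

Lemma chain_submodr A B n : chain A B n -> submodule B.
Proof. by case. Qed.

Lemma chain_sub A B n : chain A B n -> A `<=` B.
Proof.
by elim=> // {}B C k _ AB _ BC; apply: subset_trans AB _; exact: properW.
Qed.

(** Only the last term is replaced by a larger one, so the number of strict steps is unchanged. *)
Lemma chain_widenr A B C n : chain A B n -> submodule C -> B `<=` C -> chain A C n.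
Proof.
case=> {n} [{}B sA sB AB|{}B D n cB sD BD] sC DC.
  by apply: chain_nil => //; exact: subset_trans DC.
apply: chain_rcons cB sC _; split; first exact: subset_trans (properW BD) DC.
by move=> CB; case: BD => _; apply; exact: subset_trans CB.
Qed.

Lemma chain_widenl A A' B n : chain A B n -> submodule A' -> A' `<=` A -> chain A' B n.
Proof.
move=> cA sA' A'A; elim: cA => [{}B sA sB AB|{}B D k _ IH sD BD].
  by apply: chain_nil => //; exact: subset_trans AB.
exact: chain_rcons IH sD BD.
Qed.

Lemma chain_cat A B C m n : chain A B m -> chain B C n -> chain A C (m + n)%N.
Proof.
move=> cAB; elim=> [{}C _ sC BC|D E k _ IH sE DE].
  by rewrite addn0; exact: chain_widenr cAB sC BC.
by rewrite addnS; exact: chain_rcons IH sE DE.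
Qed.

Lemma chain_same A n : chain A A n -> n = 0%N.
Proof.
move AB: {2}A => B c; case: c AB => // {}B C k cB _ [_ nCB] AC'.
by case: nCB; rewrite -AC'; exact: chain_sub cB.
Qed.

Lemma len_le_mono A B m n : (m <= n)%N -> len_le A B m -> len_le A B n.
Proof. by move=> mn l k /l /leq_trans; apply. Qed.

Lemma len_le_suffix A B C l n :
  chain A B l -> len_le A C (l + n)%N -> len_le B C n.
Proof. by move=> cAB lAC k /(chain_cat cAB) /lAC; rewrite leq_add2l. Qed.

Lemma len_le_sub A B A' B' n : submodule A -> submodule B ->
  A `<=` A' -> B' `<=` B -> len_le A B n -> len_le A' B' n.
Proof.
by move=> sA sB AA BB l k c; apply: l; apply: chain_widenr (chain_widenl c _ _) _ _.
Qed.

Lemma len_le0 A B : submodule A -> submodule B -> (B `<=` A) -> len_le A B 0%N.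
Proof.
move=> sA sB BA k /(chain_widenr) /(_ sA BA) /chain_same -> //.
Qed.

(** The lengths of chains form a nonempty bounded set of naturals, and its maximum is attained. *)
Lemma exact_length A B n : submodule A -> submodule B -> A `<=` B ->
  len_le A B n -> exists l, chain A B l /\ len_le A B l.
Proof.
move=> sA sB AB lAB.
have exP : exists k, `[< chain A B k >] by exists 0; apply/asboolP; exact: chain_nil.
have ubP k : `[< chain A B k >] -> (k <= n)%N by move=> /asboolP /lAB.
case: (ex_maxnP exP ubP) => l /asboolP cl lmax; exists l; split=> // k ck.
by apply: lmax; apply/asboolP.
Qed.

End Chains.

Section ChainMaps.
Variables (R : comNzRingType) (M N1 N2 : lmodType R).

(* Each strict step of a chain stays strict under at least one of [phi], [psi]. *)
Lemma chain_map2 (phi : set M -> set N1) (psi : set M -> set N2) A B n :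
  (forall C, submodule C -> submodule (phi C)) ->
  (forall C, submodule C -> submodule (psi C)) ->
  {homo phi : C D / C `<=` D} -> {homo psi : C D / C `<=` D} ->
  (forall C D, submodule C -> submodule D ->
    A `<=` C -> C `<=` D -> D `<=` B ->
    phi D `<=` phi C -> psi D `<=` psi C -> D `<=` C) ->
  chain A B n ->
  exists t u, [/\ chain (phi A) (phi B) t, chain (psi A) (psi B) u & (n <= t + u)%N].
Proof.
move=> sphi spsi mphi mpsi inj c.
elim: c inj => {n} [{}B sA sB AB|{}B C n cB IH sC BC] inj.
  exists 0%N, 0%N; split=> //; apply: chain_nil;
    by do ?[exact: sphi|exact: spsi|exact: mphi|exact: mpsi].
have BC' := properW BC.
case: IH => [C' D sC' sD AsC' C'D DB|t [u [ct cu ntu]]].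
  by apply: inj => //; exact: subset_trans BC'.
have [phiCB|phiCB] := pselect (phi C `<=` phi B).
  exists t, u.+1; split; [|apply: chain_rcons cu (spsi _ sC) _|by rewrite addnS].
    by apply: chain_widenr ct (sphi _ sC) (mphi _ _ BC').
  split; first exact: mpsi.
  move=> psiCB; case: BC => _; apply.
  by apply: inj (chain_submodr cB) sC (chain_sub cB) BC' _ _ _ => //.
exists t.+1, u; split; [apply: chain_rcons ct (sphi _ sC) _| |by rewrite addSn].
  by split=> //; exact: mphi.
by apply: chain_widenr cu (spsi _ sC) (mpsi _ _ BC').
Qed.

End ChainMaps.

(** * Additivity of length *)

Section Lengths.
Variables (R : comNzRingType) (M : lmodType R).
Implicit Types (A B C D : set M).

Lemma chain_map (N : lmodType R) (phi : set M -> set N) A B n :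
  (forall C, submodule C -> submodule (phi C)) ->
  {homo phi : C D / C `<=` D} ->
  (forall C D, submodule C -> submodule D ->
    A `<=` C -> C `<=` D -> D `<=` B -> phi D `<=` phi C -> D `<=` C) ->
  chain A B n -> chain (phi A) (phi B) n.
Proof.
move=> sphi mphi inj c.
elim: c inj => {n} [{}B sA sB AB|{}B C n cB IH sC BC] inj.
  by apply: chain_nil; [exact: sphi..|exact: mphi].
have BC' := properW BC.
apply: chain_rcons (IH _) (sphi _ sC) _ => [C' D sC' sD AsC' C'D DB|].
  by apply: inj => //; exact: subset_trans BC'.
split=> [|CB]; first exact: mphi.
case: BC => _; apply; apply: inj (chain_submodr cB) sC (chain_sub cB) BC' _ _ => //.
Qed.

(** By the modular law, two nested submodules with the same intersection with [B] and the same sum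
    with [B] are equal. Hence each strict step survives in [D & B] or in [D + B]. *)
Lemma len_le_add A B C m n : submodule B -> A `<=` B -> B `<=` C ->
  len_le A B m -> len_le B C n -> len_le A C (m + n)%N.
Proof.
move=> sB AB BC lAB lBC k c.
have [t [u [ct cu ktu]]] : exists t u,
    [/\ chain (A `&` B) (C `&` B) t, chain (smadd A B) (smadd C B) u & (k <= t + u)%N].
  apply: (@chain_map2 R M M M (fun D => D `&` B) (fun D => smadd D B) A C k);
    last exact: c.
  - by move=> D sD; exact: submoduleI.
  - by move=> D sD; exact: submodule_smadd.
  - by move=> D E DE; exact: setSI.
  - by move=> D E DE _ [u [v [Du Bv ->]]]; exists u, v; split=> //; exact: DE.
  - move=> D E sD sE AD DE EC ED_I ED_add e Ee.
    have [d [b [Dd Bb eE]]] := ED_add _ (sub_smaddl sB Ee).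
    rewrite eE; apply: submodD => //.
    have Eb : E b by apply: (submodDl (v := d)) => //; [exact: DE|rewrite addrC -eE].
    by have [] := ED_I b (conj Eb Bb).
apply: leq_trans ktu _; apply: leq_add; [apply: lAB|apply: lBC].
- by move: ct; rewrite (setIidl AB) (setIidr BC).
- have [sA sC] := (chain_submodl c, chain_submodr c).
  apply: (chain_widenr (chain_widenl cu sB _) sC); first exact: sub_smaddr.
  exact: smadd_sub sC (@subset_refl _ C) BC.
Qed.

(** This reflects the isomorphism of [(A + R z) / A] with [R / colon A z]: a submodule between [A]
    and [A + R z] is determined by its colon ideal at [z]. *)
Lemma len_le_cyc A z n : submodule A ->
  len_le (colon A z) [set: R^o] n -> len_le A (smadd A (cyc z)) n.
Proof.
move=> sA l k c; apply: l.
suff : chain (colon A z) (colon (smadd A (cyc z)) z) k.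
  by move/chain_widenr; apply=> //; exact: submodule_setT.
apply: (@chain_map R^o (fun C => colon C z) A (smadd A (cyc z))); last exact: c.
- by move=> C; exact: submodule_colon.
- by move=> C D CD r; exact: CD.
- move=> C D sC sD AsC CD DAz cDC y Dy.
  have /smadd_cycP[u [r [Au yE]]] := DAz _ Dy.
  rewrite yE; apply: submodD => //; first exact: AsC.
  apply: cDC; rewrite /colon /=; apply: (submodDl (v := u)) => //.
    by apply: CD; exact: AsC.
  by rewrite addrC -yE.
Qed.

(** Nested submodules with the same image under [x] and the same intersection with its kernel
    coincide, so each strict step shows up in the kernel or in the image. *)
Lemma chain_ker_im (x : R) A B n : chain A B n -> exists t u,
  [/\ chain (A `&` killed [set x]) (B `&` killed [set x]) t,
      chain (scaleset x A) (scaleset x B) u & (n <= t + u)%N].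
Proof.
apply: (@chain_map2 R M M M (fun D => D `&` killed [set x]) (scaleset x)).
- by move=> C sC; apply: submoduleI => //; exact: submodule_killed.
- by move=> C; exact: submodule_scaleset.
- by move=> C D CD; exact: setSI.
- by move=> C D CD _ [u Cu <-]; exists u => //; exact: CD.
- move=> C D sC sD _ CD _ kDC sDC y Dy.
  have [z Cz xzE] := sDC (x *: y) (ex_intro2 _ _ y Dy erefl).
  have /kDC[Cyz _] : (D `&` killed [set x]) (y - z).
    split; first by apply: submodB => //; exact: CD.
    by move=> _ ->; rewrite scalerBr xzE subrr.
  by apply: (submodDl (v := - z)) => //; rewrite -scaleN1r; exact: submodZ.
Qed.

End Lengths.

(** * Submodules as modules in their own right *)

Section SubmoduleType.
Variables (R : comNzRingType) (M : lmodType R) (N : set M) (sN : submodule N).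

(** Injectivity quantifies over module types, so a submodule must become one. The closure proof is
    an argument so that the module structure can be attached to the type. *)
Definition submod_type of submodule N : Type := {x : M | x \in N}.
HB.instance Definition _ := SubType.copy (submod_type sN) {x : M | x \in N}.
HB.instance Definition _ := [Choice of submod_type sN by <:].
HB.instance Definition _ :=
  GRing.SubChoice_isSubLmodule.Build R M [in N] (submod_type sN)
    (GRing.submod_closed_semi sN).

Definition submod_incl (x : submod_type sN) : M := \val x.

Lemma submod_incl_is_linear : linear submod_incl.
Proof. by []. Qed.

HB.instance Definition _ :=
  GRing.isLinear.Build R (submod_type sN) M _ submod_incl submod_incl_is_linear.

Lemma submod_inclP x : N (submod_incl x).
Proof. by apply: set_mem; exact: valP. Qed.

Lemma submod_incl_inj : injective submod_incl.
Proof. exact: val_inj. Qed.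

Lemma submod_incl_surj x : N x -> exists y, submod_incl y = x.
Proof. by move=> Nx; exists (exist _ x (mem_set Nx)). Qed.

End SubmoduleType.

(** * Indecomposable injective modules are uniform *)

Section Uniform.
Variables (R : comNzRingType) (E : lmodType R).
Implicit Types (A B C D N : set E).

Definition uniform := forall u v : E, u != 0 -> v != 0 ->
  exists r s : R, r *: u = s *: v /\ r *: u != 0.

(** Zorn's lemma, applied to the submodules that contain [N2] and meet [N1] trivially. *)
Lemma exists_complement N1 N2 : submodule N1 -> submodule N2 ->
  N1 `&` N2 `<=` [set 0] ->
  exists C, [/\ submodule C, N2 `<=` C, N1 `&` C `<=` [set 0] &
    forall B, submodule B -> C `<=` B -> N1 `&` B `<=` [set 0] -> B `<=` C].
Proof.
move=> sN1 sN2 N12.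
pose good C := [/\ submodule C, N2 `<=` C & N1 `&` C `<=` [set 0]].
have [F FP Ftot|C [[C0|[sC N2C N1C]] Cmax]] :=
    @Zorn_bigcup E (fun C => C = set0 \/ good C).
- have [[C0 FC0 [z C0z]]|F0] := pselect (exists2 C, F C & C !=set0); last first.
    left; rewrite -subset0 => z [C FC Cz]; apply: F0; exists C => //; by exists z.
  have goodF C y : F C -> C y -> good C.
    by move=> FC Cy; have [C_0|//] := FP _ FC; move: Cy; rewrite C_0.
  right; have [sC0 N2C0 _] := goodF _ _ FC0 C0z; split.
  + apply/submoduleP; split; first by exists C0 => //; exact: submod0.
    move=> a u v [C FC Cu] [D FD Dv].
    have [CD|DC] := Ftot _ _ FC FD.
      exists D => //; have [sD _ _] := goodF _ _ FD Dv.
      by apply: submodZD => //; exact: CD.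
    exists C => //; have [sD _ _] := goodF _ _ FC Cu.
    by apply: submodZD => //; exact: DC.
  + by move=> u N2u; exists C0 => //; exact: N2C0.
  + by move=> u [N1u [C FC Cu]]; have [_ _] := goodF _ _ FC Cu; apply.
- exfalso; apply: (Cmax N2); last by right; split.
  by rewrite C0; split=> [u []|/(_ 0 (submod0 sN2))].
- exists C; split=> // B sB CB N1B.
  apply: contrapT => nBC; apply: (Cmax B); first by split.
  by right; split=> //; exact: subset_trans CB.
Qed.

(** The sum map from [A * B] to [E] is injective because [A] and [B] meet trivially, so the first
    projection extends along it. *)
Lemma injective_extend_projection A B : injective_module E ->
  submodule A -> submodule B -> A `&` B `<=` [set 0] ->
  exists h : {linear E -> E},
    (forall a, A a -> h a = a) /\ (forall b, B b -> h b = 0).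
Proof.
move=> injE sA sB AB.
pose S : lmodType R := (submod_type sA * submod_type sB)%type.
pose i (p : submod_type sA * submod_type sB) : E := submod_incl p.1 + submod_incl p.2.
have lini : linear i.
  by move=> a u v; rewrite /i !linearP /= scalerDr addrACA.
pose f (p : submod_type sA * submod_type sB) : E := submod_incl p.1.
have linf : linear f by move=> a u v; rewrite /f !linearP.
pose I : {linear S -> E} := HB.pack i (GRing.isLinear.Build R S E _ i lini).
pose F : {linear S -> E} := HB.pack f (GRing.isLinear.Build R S E _ f linf).
have injI : injective I.
  move=> [u v] [u' v']; rewrite /= /i /= => e.
  have e' : submod_incl u - submod_incl u' = submod_incl v' - submod_incl v.
    apply/eqP; rewrite subr_eq addrAC eq_sym subr_eq addrC.
    by rewrite -e addrC.
  have u0 : submod_incl u - submod_incl u' = 0.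
    apply: AB; split; last rewrite e'; apply: submodB => //; exact: submod_inclP.
  have v0 : submod_incl v' - submod_incl v = 0 by rewrite -e'.
  by congr pair; apply: submod_incl_inj; apply/esym/eqP;
    rewrite -subr_eq0 ?v0// -opprB u0 oppr0.
have [h hE] := injE S E I F injI.
exists h; split=> [a /(submod_incl_surj sA)[y <-]|b /(submod_incl_surj sB)[y <-]].
- by have := hE (y, 0); rewrite /= /i /f /= raddf0 addr0.
- by have := hE (0, y); rewrite /= /i /f /= raddf0 add0r.
Qed.

(** If [R u] and [R v] met trivially, enlarging them to [C] and [D], each maximal against the other,
    would give a decomposition [E = C + D]: the projection onto [D] along [C] extends to all of
    [E]. *)
Lemma indecomposable_injective_uniform :
  indecomposable E -> injective_module E -> uniform.
Proof.
move=> [_ indec] injE u v u0 v0; apply: contrapT => nuv.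
have uv0 : cyc v `&` cyc u `<=` [set 0].
  move=> _ [[s _ <-] [r _ e]] /=; apply: contrapT => /eqP sv0; apply: nuv.
  by exists r, s; rewrite e.
have [scu scv] := (submodule_cyc u, submodule_cyc v).
have [C [sC uC vC Cmax]] := exists_complement scv scu uv0.
have [D [sD vD CD Dmax]] : exists D,
  [/\ submodule D, cyc v `<=` D, C `&` D `<=` [set 0] &
    forall B, submodule B -> D `<=` B -> C `&` B `<=` [set 0] -> B `<=` D].
  by apply: exists_complement => //; rewrite setIC.
have [h [hD hC]] : exists h : {linear E -> E},
    (forall a, D a -> h a = a) /\ (forall b, C b -> h b = 0).
  by apply: injective_extend_projection => //; rewrite setIC.
(* By maximality of [C], the kernel of the projection extended to [E] is [C]. *)
have kerC x : h x = 0 -> C x.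
  have sK : submodule [set x | h x = 0].
    apply/submoduleP; split; first by rewrite /= raddf0.
    by move=> a y z /= hy hz; rewrite linearP hy hz scaler0 addr0.
  apply: (Cmax _ sK hC) => y [/vD Dy /= hy]; by rewrite /= -hy hD.
(* By maximality of [D], its image is [D]. *)
have imD x : D (h x).
  have sI : submodule (range h).
    apply/submoduleP; split; first by exists 0 => //; rewrite raddf0.
    by move=> a _ _ [y _ <-] [z _ <-]; exists (a *: y + z) => //; rewrite linearP.
  apply: (Dmax _ sI) => [y Dy|w [Cw [z _ zw]]|]; last by exists x.
    by exists y => //; exact: hD.
  move: Cw; rewrite -{w}zw => Chz; have sCz := submodule_smadd sC (submodule_cyc z).
  (* An element [y = c + r z] of [R v] is fixed by [h], so [y = r (h z)] lies in both [C] and [D]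
     and vanishes. Maximality of [C] then absorbs [z]. *)
  suff Cz : C z by exact: hC.
  apply: (Cmax _ sCz (sub_smaddl (submodule_cyc z))); last first.
    by apply: sub_smaddr => //; exact: cycx.
  move=> y [/vD Dy /smadd_cycP[c [r [Cc yE]]]]; apply: CD; split=> //.
  by rewrite -(hD _ Dy) yE raddfD /= hC // add0r linearZ; exact: submodZ.
have [] := indec C D sC sD.
- move=> x; exists (x - h x), (h x); split=> //; last by rewrite subrK.
  by apply: kerC; rewrite raddfB /= [h (h x)]hD ?subrr.
- by apply/seteqP; split=> // _ ->; split; exact: submod0.
- by move=> C0; move: u0; have := uC _ (cycx u); rewrite C0 => -> /eqP.
- by move=> D0; move: v0; have := vD _ (cycx v); rewrite D0 => -> /eqP.
Qed.

End Uniform.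

(** * Noetherian induction, locality and dimension *)

Section Ideals.
Variable R : comNzRingType.
Implicit Types (I J Q m : set R^o).

Definition is_prime I :=
  [/\ submodule I, ~ I 1 & forall a b : R, I (a * b) -> I a \/ I b].

(** Locality as the existence of a largest proper ideal; [m] is then exactly the set of nonunits. *)
Definition local_at m :=
  [/\ submodule m, ~ m 1 & forall J, submodule J -> ~ J 1 -> J `<=` m].

Lemma submod_mulr I (a b : R) : submodule I -> I b -> I (a * b).
Proof. by move=> sI Ib; have := submodZ a sI Ib. Qed.

Lemma idealr_closedP I : idealr_closed [in I : set R] <-> submodule I /\ ~ I 1.
Proof.
split=> [[I0 I1 Iid]|[/submoduleP[I0 Iid] I1]].
  split; last by move=> i1; move/negP: I1; apply; rewrite !inE.
  apply/submoduleP; split; first by move: I0; rewrite inE.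
  by move=> a u v Iu Iv; have := Iid a u v; rewrite !inE; apply.
split; first by rewrite inE.
  by apply/negP; rewrite inE.
by move=> a u v; rewrite !inE; exact: Iid.
Qed.

Lemma is_prime_ideal I : is_prime I -> prime_ideal I.
Proof.
move=> [sI I1 pI]; split; first exact/idealr_closedP.
move=> a b; rewrite !inE => /pI[Ia|Ib]; apply/orP; [left|right]; by rewrite inE.
Qed.

(** A failure would propagate: every bad ideal lies strictly inside another bad one, and iterating a
    choice function gives a strictly increasing sequence whose union is finitely generated, a
    contradiction. *)
Lemma noetherian_ind (P : set R^o -> Prop) : noetherian R ->
  (forall I, submodule I -> (forall J, submodule J -> I `<` J -> P J) -> P I) ->
  forall I, submodule I -> P I.
Proof.
move=> noeth step I0 sI0; apply: contrapT => nPI0.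
pose bad I := submodule I /\ ~ P I.
have /choice[f fP] : forall I, exists J, bad I -> bad J /\ I `<` J.
  move=> I; have [[sI nPI]|nbad] := pselect (bad I); last by exists I.
  apply: contrapT => nJ; apply: nPI; apply: step => // J sJ IJ.
  by apply: contrapT => nPJ; apply: nJ; exists J.
pose F k := iter k f I0.
have badF k : bad (F k) by elim: k => [|k IH]; [split|exact: (fP _ IH).1].
have FS k : F k `<` F k.+1 by exact: (fP _ (badF k)).2.
have Fmono i j : (i <= j)%N -> F i `<=` F j.
  move=> /subnK <-; elim: (j - i)%N => // k IH.
  by rewrite addSn; apply: subset_trans IH _; exact: properW.
pose U := \bigcup_k F k.
have sU : submodule U.
  apply/submoduleP; split; first by exists 0%N => //; exact: submod0.
  move=> a u v [i _ Fu] [j _ Fv]; exists (maxn i j) => //.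
  apply: submodZD; first exact: (badF _).1.
    by apply: Fmono Fu; exact: leq_maxl.
  by apply: Fmono Fv; exact: leq_maxr.
have [s Us] := noeth U sU.
(* The finitely many generators of the union already lie in one stage, where the sequence would have
   to stop. *)
have [K sK] : exists K, forall z, z \in s -> F K z.
  have : forall z, z \in s -> U z by move=> z zs; rewrite Us; exact: mem_lspan.
  elim: s {Us} => [|a s IH] sU'; first by exists 0%N.
  have [K FK] := IH (fun z zs => sU' z (mem_behead (s := a :: s) zs)).
  have [j _ Fj] := sU' a (mem_head a s).
  exists (maxn K j) => z; rewrite inE => /orP[/eqP ->|/FK Fz].
    by apply: Fmono Fj; exact: leq_maxr.
  by apply: Fmono Fz; exact: leq_maxl.
have [_ []] := FS K; apply: subset_trans (_ : U `<=` _).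
  by move=> z Fz; exists K.+1.
by rewrite Us; apply: lspan_sub => //; exact: (badF K).1.
Qed.

(** A proper ideal that is not prime contains a product [a * b] of elements outside it, so the
    induction only splits there. *)
Lemma noetherian_devissage (P : set R^o -> Prop) : noetherian R ->
  (forall I, submodule I -> I 1 -> P I) ->
  (forall I, is_prime I -> P I) ->
  (forall I (a b : R), submodule I -> ~ I a -> ~ I b -> I (a * b) ->
    (forall J, submodule J -> I `<` J -> P J) -> P I) ->
  forall I, submodule I -> P I.
Proof.
move=> noeth unitP primeP splitP; apply: noetherian_ind => // I sI IH.
have [I1|I1] := pselect (I 1); first exact: unitP.
have [pI|npI] := pselect (is_prime I); first exact: primeP.
apply: contrapT => nPI; apply: npI; split=> // a b Iab.
apply: contrapT => /not_orP[Ia Ib].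
by apply: nPI; exact: (splitP _ a b).
Qed.

(** By Noetherian induction a proper ideal is maximal, hence equal to [m], or lies strictly inside a
    proper ideal already known to lie in [m]. *)
Lemma local_ring_at : noetherian R -> local_ring R -> exists m, local_at m.
Proof.
move=> noeth [m [[/idealr_closedP[sm m1] mmax] muniq]]; exists m; split=> //.
apply: noetherian_ind => // J sJ IH J1.
have [mJ|nJ] := pselect (maximal_ideal (J : set R)).
  by rewrite -(muniq _ mJ).
have [K [/idealr_closedP[sK K1] JK KJ]] : exists K : set R^o,
    [/\ idealr_closed [in K : set R], J `<=` K & K <> J].
  apply: contrapT => nK; apply: nJ; split; first exact/idealr_closedP.
  by move=> K Kid JK; apply: contrapT => KJ; apply: nK; exists K.
apply: (subset_trans JK); apply: IH => //; split=> // KJ'.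
by apply: KJ; apply/seteqP.
Qed.

Lemma local_unit m (r : R) : local_at m -> ~ m r -> exists s, s * r = 1.
Proof.
move=> [sm m1 mmax] mr; apply: contrapT => nr; apply: mr.
apply: (mmax (cyc (r : R^o))); [exact: submodule_cyc| |exact: cycx].
by move=> [s _ sr]; apply: nr; exists s.
Qed.

(** Elements outside [m] are units, so [m] is prime; if [J] differed from [m], then [Q], [J], [m]
    would be a chain of length two. *)
Lemma prime_above_eq m Q J : (krull_dim R <= 1%:Z%:E)%E -> local_at m ->
  is_prime Q -> is_prime J -> Q `<` J -> J = m.
Proof.
move=> dim1 [sm m1 mmax] pQ pJ QJ.
have [sJ J1 _] := pJ.
have Jm := mmax _ sJ J1.
apply: contrapT => nJm.
have JmP : J `<` m by split=> // mJ; apply: nJm; apply/seteqP.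
have pm : is_prime m.
  split=> // a b mab; apply: contrapT => /not_orP[ma mb].
  have loc : local_at m by [].
  have [s sa] := local_unit loc ma; apply: mb.
  by rewrite -[b]mul1r -sa -mulrA; exact: submod_mulr.
suff : (2 <= 1)%N by [].
move: dim1; rewrite /krull_dim => /nat_sup_leP; apply.
exists (fun i => if i is i'.+1 then if i' is _.+1 then m else J else Q).
split=> [[|[|i]] _|[|[|i]]] //; exact: is_prime_ideal.
Qed.

End Ideals.

(** * Finite length and numbers of generators *)

Section SimpleSteps.
Variables (R : comNzRingType) (M : lmodType R).
Implicit Types (A B C : set M).

Lemma len_le1 A B :
  (forall C, submodule C -> A `<=` C -> C `<=` B -> C `<=` A \/ B `<=` C) ->
  len_le A B 1.
Proof.
move=> simple k c; case: c simple => // {}B C {}k cB _ [BC nCB] simple.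
case: cB BC nCB => // {}B D j cB sD [BD nDB] DC nCD.
have AD : A `<=` D by apply: subset_trans BD; exact: chain_sub cB.
have [DA|//] := simple D sD AD DC.
by case: nDB; apply: subset_trans DA _; exact: chain_sub cB.
Qed.

(** Generators are added one at a time. Colon ideals grow with [A], so the finiteness assumption
    passes to the enlarged submodule. *)
Lemma finite_length_lspan A (s : seq M) : submodule A ->
  (forall z, z \in s -> exists n, len_le (colon A z) [set: R^o] n) ->
  exists n, len_le A (smadd A (lspan s)) n.
Proof.
elim: s A => [|z s IH] A sA fin.
  exists 0%N; apply: len_le0 => //.
    by apply: submodule_smadd => //; exact: submodule_lspan.
  apply: smadd_sub => // _ [c _ <-]; rewrite big_ord0; exact: submod0.
have sz := submodule_cyc z; have ss := submodule_lspan s.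
have sAz := submodule_smadd sA sz.
have [p lp] := fin z (mem_head z s).
have [|q lq] := IH _ sAz.
  move=> y ys; have [n ln] := fin y (mem_behead (s := z :: s) ys); exists n.
  apply: len_le_sub ln; [exact: submodule_colon|exact: submodule_setT| |by []].
  by move=> r Ar; exact: (sub_smaddl sz Ar).
exists (p + q)%N.
apply: (@len_le_sub _ _ A (smadd (smadd A (cyc z)) (lspan s))) => //.
- exact: submodule_smadd.
- apply: smadd_sub; first exact: submodule_smadd.
    by apply: subset_trans (sub_smaddl ss); exact: sub_smaddl.
  apply: lspan_sub => [|y]; first exact: submodule_smadd.
  rewrite inE => /orP[/eqP ->|/mem_lspan]; last exact: sub_smaddr.
  by apply: sub_smaddl => //; apply: sub_smaddr => //; exact: cycx.
- apply: len_le_add (len_le_cyc sA lp) lq => //; exact: sub_smaddl.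
Qed.

(* A minimal generating family stays independent modulo [x X]: since [1 - x r]
   is a unit, a generator in [x X] plus the others is redundant. *)
Lemma gen_le_len m (x : R) (s : seq M) n : local_at m -> m x ->
  len_le (scaleset x (lspan s)) (lspan s) n ->
  exists t : seq M, (size t <= n)%N /\ lspan s = lspan t.
Proof.
move=> loc mx; have [sm m1 mmax] := loc.
elim/ltn_ind: (size s) {-2}s (erefl (size s)) => k IH {}s sk lX.
have [[s1 [a [s2 [sE red]]]]|irr] := pselect (exists s1 a s2, s = s1 ++ a :: s2 /\
    smadd (scaleset x (lspan s)) (lspan s2) a).
  have sub12 : lspan (s1 ++ s2) `<=` lspan s.
    rewrite sE; apply: lspan_subset => z.
    by rewrite !mem_cat inE => /orP[]->; rewrite ?orbT.
  have s12 := submodule_lspan (s1 ++ s2).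
  have a12 : lspan (s1 ++ s2) a.
    have [_ [w [[y Xy <-] ws2 aE]]] := red.
    have w12 : lspan (s1 ++ s2) w.
      by apply: lspan_subset ws2 => z; rewrite mem_cat orbC => ->.
    move: Xy; rewrite sE => /lspan_insert[r [w' [w'12 yE]]].
    have [|v v1] := @local_unit _ m (1 - x * r) loc.
      move=> mxr; apply: m1; apply: (@submodDl R R^o m 1 (- (x * r)) sm) => //.
      by rewrite -mulrN mulrC; exact: submod_mulr.
    have -> : a = v *: (x *: w' + w).
      rewrite -[a in LHS]scale1r -v1 -scalerA; congr (_ *: _).
      apply/eqP; rewrite scalerBl scale1r subr_eq; apply/eqP.
      by rewrite [LHS]aE yE scalerDr scalerA [RHS]addrC addrA.
    by apply: submodZ => //; exact: submodZD.
  have eqX : lspan s = lspan (s1 ++ s2).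
    apply/seteqP; split=> //; rewrite sE; apply: lspan_sub => // z.
    rewrite mem_cat inE orbCA => /orP[/eqP ->//|z12].
    by apply: mem_lspan; rewrite mem_cat.
  rewrite eqX; apply: (IH (size (s1 ++ s2))) => //; last by rewrite -eqX.
  by rewrite -sk sE !size_cat /= addnS.
exists s; split=> //; apply: lX.
have sX := submodule_lspan s; have sxX := submodule_scaleset x sX.
(* In the irredundant case, adding the generators to [x X] from the last to the first makes every
   step strict, so [size s] is at most the length of [X / x X]. *)
suff : forall s2 s1, s = s1 ++ s2 ->
    chain (scaleset x (lspan s)) (smadd (scaleset x (lspan s)) (lspan s2)) (size s2).
  move=> /(_ s [::] erefl) /chain_widenr; apply=> //.
  by apply: smadd_sub => //; exact: scaleset_sub.
elim=> [|a s2 IHs] s1 sE.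
  apply: chain_nil => //; first exact: submodule_smadd sxX (submodule_lspan _).
  exact: sub_smaddl (submodule_lspan _).
have ss2 := submodule_lspan s2; have sas2 := submodule_lspan (a :: s2).
apply: chain_rcons (submodule_smadd sxX sas2) _.
  by apply: (IHs (rcons s1 a)); rewrite cat_rcons.
split.
  apply: smadd_sub; [exact: submodule_smadd|exact: sub_smaddl|].
  apply: subset_trans (sub_smaddr sxX); apply: lspan_subset => z zs2.
  by rewrite inE zs2 orbT.
move=> sub; apply: irr; exists s1, a, s2; split=> //; apply: sub.
by apply: sub_smaddr => //; apply: mem_lspan; exact: mem_head.
Qed.

End SimpleSteps.

(** * Length bounds above a prime *)

Section FiniteLength.
Variable R : comNzRingType.
Implicit Types (I J Q m : set R^o).

(** If [r z = s c] is nonzero and [m] kills [z], then [r] is a unit and [z] lies in [R c]; so any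
    nonzero submodule is the whole socle. *)
Lemma uniform_socle_len_le m (E : lmodType R) : local_at m -> uniform E ->
  len_le [set 0] (killed m : set E) 1.
Proof.
move=> loc unifE; apply: len_le1 => C sC _ Cm.
have [[c Cc c0]|C0] := pselect (exists2 c, C c & c != 0); last first.
  by left=> c Cc /=; apply: contrapT => /eqP c0; apply: C0; exists c.
right=> z mz; have [->|z0] := eqVneq z 0; first exact: submod0.
have [r [s [rzsc rz0]]] := unifE z c z0 c0.
have [|v vr] := @local_unit _ m r loc; first by move=> /mz rz; rewrite rz eqxx in rz0.
by rewrite -[z]scale1r -vr -scalerA rzsc; do 2!apply: submodZ => //.
Qed.

Lemma proper_smadd_cyc I (a : R^o) : submodule I -> ~ I a -> I `<` smadd I (cyc a).
Proof.
move=> sI Ia; split=> [|Iaa]; first exact: sub_smaddl (submodule_cyc a).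
by apply: Ia; apply: Iaa; apply: sub_smaddr => //; exact: cycx.
Qed.

Lemma proper_colon I (a b : R) : submodule I -> I (a * b) -> ~ I b ->
  I `<` colon I (a : R^o).
Proof.
move=> sI Iab Ib; split=> [r Ir|Iaa].
  by rewrite /colon /= /GRing.scale /= mulrC; exact: submod_mulr.
by apply: Ib; apply: Iaa; rewrite /colon /= /GRing.scale /= mulrC.
Qed.

Lemma killed_smadd_cyc (E : lmodType R) I (a : R) (z : E) :
  killed I z -> a *: z = 0 -> killed (smadd I (cyc (a : R^o))) z.
Proof.
move=> Iz az r /smadd_cycP[u [s [Iu ->]]].
by rewrite scalerDl Iz // add0r [s *: _]/GRing.scale /= -scalerA az scaler0.
Qed.

(** Devissage with a single number for both bounds. When [a * b] lies in [I], the ideals [I + R a]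
    and [colon I a] control both [R / I] and the elements killed by [I]. *)
Lemma finite_length_above m Q : noetherian R -> local_at m ->
  (forall J, is_prime J -> Q `<` J -> J = m) ->
  forall J, submodule J -> Q `<` J ->
  exists n, len_le J [set: R^o] n /\
    forall E : lmodType R, uniform E -> len_le [set 0] (killed J : set E) n.
Proof.
move=> noeth loc above.
apply: (@noetherian_devissage R (fun J => Q `<` J -> exists n, _)) => //.
- move=> I sI I1 _; exists 0%N; split.
    apply: len_le0 => //; first exact: submodule_setT.
    by move=> r _; rewrite -[r]mulr1; exact: submod_mulr.
  move=> E _; apply: len_le0; [exact: submodule_set0|exact: submodule_killed|].
  by move=> z /(_ _ I1); rewrite scale1r.
- move=> I pI QI; rewrite (above _ pI QI); exists 1%N; split; last first.
    by move=> E; exact: uniform_socle_len_le.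
  have [sm m1 mmax] := loc; apply: len_le1 => C sC mC _.
  have [C1|C1] := pselect (C 1); last by left; exact: mmax.
  by right=> r _; rewrite -[r]mulr1; exact: submod_mulr.
- move=> I a b sI Ia Ib Iab IH QI.
  have Isub := proper_smadd_cyc sI Ia; have Icol := proper_colon sI Iab Ib.
  have sIa := submodule_smadd sI (submodule_cyc (a : R^o)).
  have sIc := submodule_colon (a : R^o) sI.
  have Qtrans K : I `<` K -> Q `<` K.
    move=> IK; split; first exact: subset_trans (properW QI) (properW IK).
    by move=> KQ; case: IK => _; apply; exact: subset_trans KQ (properW QI).
  have [p [pl pk]] := IH _ sIa Isub (Qtrans _ Isub).
  have [q [ql qk]] := IH _ sIc Icol (Qtrans _ Icol).
  exists (q + p)%N; split.
    exact: len_le_add sIa (properW Isub) _ (len_le_cyc sI ql) pl.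
  (* The kernel of [a] on the elements killed by [I] is killed by [I + R a], and the image by
     [colon I a]. *)
  move=> E unifE k /(chain_ker_im (a : R))[t [u [ct cu ktu]]].
  apply: (leq_trans ktu); rewrite addnC; apply: leq_add.
    apply: (qk E unifE); apply: chain_widenl (chain_widenr cu _ _) _ _.
    + exact: submodule_killed.
    + move=> _ [z Iz <-] r; rewrite /colon /= => Ira; rewrite scalerA.
      exact: Iz.
    + exact: submodule_set0.
    + by move=> _ ->; exists 0 => //; rewrite scaler0.
  apply: (pk E unifE); apply: chain_widenl (chain_widenr ct _ _) _ _.
  + exact: submodule_killed.
  + by move=> z [Iz az]; apply: killed_smadd_cyc => //; exact: az.
  + exact: submodule_set0.
  + by move=> _ ->; split=> // r _; rewrite scaler0.
Qed.

(** * The length of [X / x X] when a prime kills [X] *)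

Section PrimeCase.
Variables (E : lmodType R) (Q : set R^o) (x : R) (n : nat) (s : seq E).
Hypothesis unifE : uniform E.
Hypothesis Qprime : is_prime Q.
Hypothesis above : forall K, submodule K -> Q `<` K ->
  exists k, len_le K [set: R^o] k.
Let X := lspan s.
Hypothesis QX : X `<=` killed Q.
Let Qx := smadd Q (cyc (x : R^o)).
Hypothesis Qx_colen : len_le Qx [set: R^o] n.
Hypothesis Qx_killed : len_le [set 0] (killed Qx : set E) n.
Hypothesis nQx : ~ Q x.

Let sX : submodule X. Proof. exact: submodule_lspan. Qed.

Let sQx : submodule Qx.
Proof. by case: Qprime => sQ _ _; exact: submodule_smadd sQ (submodule_cyc _). Qed.

(** Each colon ideal of [A] at an element of [X] contains [Q] strictly, so it has finite
    colength. *)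
Let finite_length_over (A : set E) : submodule A -> A `<=` X ->
  (forall z, X z -> exists r, A (r *: z) /\ ~ Q r) ->
  exists l, chain A X l /\ len_le A X l.
Proof.
move=> sA AX fin.
have [|k lk] := @finite_length_lspan R E A s sA.
  move=> z zs; have Xz : X z by exact: mem_lspan.
  apply: above; first exact: submodule_colon.
  have [r [Arz Qr]] := fin z Xz; split=> [q Qq|/(_ r Arz)//].
  by rewrite /colon /= QX //; exact: submod0.
apply: (exact_length (n := k)) => //.
apply: len_le_sub lk => //; first exact: submodule_smadd sA sX.
exact: sub_smaddr.
Qed.

(* If [Q] is the annihilator of some [y] in [X], then [X / R y] has finite length
   and [x] is injective on [X], so that [X / x X] and [R y / x R y] have the same
   length. *)
Lemma torsionfree_len_le y : X y -> (forall r, r *: y = 0 -> Q r) ->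
  len_le (scaleset x X) X n.
Proof.
move=> Xy annQ; have [sQ Q1 pQ] := Qprime.
have y0 : y != 0 by apply/eqP => y0; apply: Q1; apply: annQ; rewrite y0 scaler0.
have frac z : X z -> z != 0 -> exists r t, [/\ ~ Q r, ~ Q t & r *: z = t *: y].
  move=> Xz z0; have [r [t [e rz0]]] := unifE z0 y0; exists r, t; split=> // Qr.
    by rewrite (QX Xz Qr) eqxx in rz0.
  by rewrite e (QX Xy Qr) eqxx in rz0.
(* For nonzero [z] with [r z = t y] and [t] outside [Q], [x z = 0] would put [x * t] in the prime
   [Q]. *)
have xinj z : X z -> x *: z = 0 -> z = 0.
  move=> Xz xz; apply: contrapT => /eqP /(frac _ Xz)[r [t [_ Qt e]]].
  have /annQ/pQ[] // : (x * t) *: y = 0.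
  by rewrite -scalerA -e scalerA mulrC -scalerA xz scaler0.
have sy := submodule_cyc y.
have [l [cl ll]] : exists l, chain (cyc y) X l /\ len_le (cyc y) X l.
  apply: finite_length_over => //; first exact: cyc_sub.
  move=> z Xz; have [->|z0] := eqVneq z 0.
    by exists 1; split=> //; rewrite scaler0; exact: submod0.
  by have [r [t [Qr _ e]]] := frac z Xz z0; exists r; split=> //; rewrite e; exists t.
have cxl : chain (scaleset x (cyc y)) (scaleset x X) l.
  apply: (chain_map _ _ _ cl).
  - by move=> C; exact: submodule_scaleset.
  - by move=> C D CD _ [u Cu <-]; exists u => //; exact: CD.
  - move=> C D sC sD _ CD DX xDC d Dd.
    have [c Cc xcd] := xDC (x *: d) (ex_intro2 _ _ d Dd erefl).
    suff -> : d = c by [].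
    apply/eqP; rewrite -subr_eq0; apply/eqP/xinj.
      by apply: submodB => //; [exact: DX|apply: DX; exact: CD].
    by rewrite scalerBr xcd subrr.
(* From [x R y] to [X] the length is at most [n + l], via [R y]; the part from [x R y] to [x X]
   already uses [l], leaving [n]. *)
apply: (len_le_suffix cxl); rewrite addnC.
have sxy := submodule_scaleset x sy.
apply: (len_le_add sy _ _ _ ll); [exact: scaleset_sub|exact: cyc_sub|].
apply: (@len_le_sub _ _ (scaleset x (cyc y))
  (smadd (scaleset x (cyc y)) (cyc y))) => //.
- exact: submodule_smadd.
- exact: sub_smaddr.
apply: len_le_cyc => //.
apply: len_le_sub Qx_colen => //; first exact: submodule_setT.
apply: smadd_sub; first exact: submodule_colon.
  by move=> q Qq; rewrite /colon /= QX //; exact: submod0.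
by apply: cyc_sub; [exact: submodule_colon|exists y => //; exact: cycx].
Qed.

(* Otherwise [X] has finite length, and [X / x X] has the length of the kernel of
   [x] on [X]. *)
Lemma torsion_len_le : (forall y, X y -> exists r, r *: y = 0 /\ ~ Q r) ->
  len_le (scaleset x X) X n.
Proof.
move=> tors; have s0 := submodule_set0 E.
have [_ ->||l [cl ll]] := finite_length_over s0; [exact: submod0|exact: tors|].
have [t [u [ct cu ltu]]] := chain_ker_im x cl.
have tn : (t <= n)%N.
  apply: Qx_killed; apply: chain_widenl (chain_widenr ct _ _) _ _ => //.
  + exact: submodule_killed.
  + by move=> z [Xz xz]; apply: killed_smadd_cyc; [exact: QX|exact: xz].
  + by move=> _ ->; split=> // r _; rewrite scaler0.
have cu0 : chain [set 0] (scaleset x X) u.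
  apply: chain_widenl cu s0 _.
  by move=> _ ->; exists 0 => //; rewrite scaler0.
(* As [l <= t + u] and [t <= n], removing the [u] steps up to [x X] leaves at most [n]. *)
apply: (len_le_suffix cu0); apply: len_le_mono ll.
by rewrite addnC; apply: leq_trans ltu _; rewrite leq_add2r.
Qed.

Lemma prime_len_le : len_le (scaleset x X) X n.
Proof.
have [[y [Xy annQ]]|nann] := pselect (exists y, X y /\ forall r, r *: y = 0 -> Q r).
  exact: (torsionfree_len_le Xy).
apply: torsion_len_le => y Xy; apply: contrapT => tors; apply: nann.
exists y; split=> // r ry; apply: contrapT => Qr; apply: tors; by exists r.
Qed.

End PrimeCase.

(** * Uniform bounds on numbers of generators *)

(** The bound is chosen before [E] and [s]: it depends on the ideal only. *)
Definition gen_bounded I := exists n, forall (E : lmodType R) (s : seq E),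
  uniform E -> lspan s `<=` killed I ->
  exists t : seq E, (size t <= n)%N /\ lspan s = lspan t.

Lemma prime_gen_bounded m Q : noetherian R -> local_at m -> is_prime Q ->
  (forall J, is_prime J -> Q `<` J -> J = m) -> gen_bounded Q.
Proof.
move=> noeth loc pQ above; have [sm m1 mmax] := loc; have [sQ Q1 _] := pQ.
have [mQ|/existsNP[x /not_implyP[mx nQx]]] := pselect (m `<=` Q).
  (* Here [X] lies in the socle, and [x = 0] makes [X / x X] equal to [X]. *)
  exists 1%N => E s unifE Qs; apply: (gen_le_len loc (submod0 sm)).
  rewrite scaleset0; last exact: submodule_lspan.
  apply: len_le_sub (uniform_socle_len_le loc unifE) => //.
  - exact: submodule_set0.
  - exact: submodule_killed.
  - by move=> z /Qs Qz r /mQ; exact: Qz.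
have fin := finite_length_above noeth loc above.
have [n [nl nk]] :=
  fin _ (submodule_smadd sQ (submodule_cyc x)) (proper_smadd_cyc sQ nQx).
exists n => E s unifE Qs; apply: (gen_le_len loc mx).
apply: (prime_len_le unifE pQ) => //; last exact: nk.
by move=> K sK QK; have [k [kl _]] := fin K sK QK; exists k.
Qed.

Lemma lspan_scale (E : lmodType R) (a : R) (s : seq E) :
  lspan [seq a *: z | z <- s] = scaleset a (lspan s).
Proof.
have ss := submodule_lspan s; apply/seteqP; split.
  apply: lspan_sub => [|_ /mapP[z zs ->]]; first exact: submodule_scaleset.
  by exists z => //; exact: mem_lspan.
suff : lspan s `<=` [set y | lspan [seq a *: z | z <- s] (a *: y)].
  by move=> sub _ [y /sub ? <-].
apply: lspan_sub => [|z zs]; last by apply: mem_lspan; exact: map_f.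
have sas := submodule_lspan [seq a *: z | z <- s].
apply/submoduleP; split; first by rewrite /= scaler0; exact: submod0.
by move=> b u v /= au av; rewrite scalerDr scalerA mulrC -scalerA; exact: submodZD.
Qed.

(* [X] is generated by lifts of generators of [a X], which [b] kills, together with
   finitely many elements killed by [a]. *)
Lemma split_gen_bounded I (a b : R) : submodule I -> I (a * b) ->
  gen_bounded (smadd I (cyc (a : R^o))) -> gen_bounded (smadd I (cyc (b : R^o))) ->
  gen_bounded I.
Proof.
move=> sI Iab [q qP] [p pP]; exists (q + p)%N => E s unifE Is.
pose X := lspan s; have sX : submodule X by exact: submodule_lspan.
have [|tb [tbp tbE]] := pP E [seq a *: z | z <- s] unifE.
  rewrite lspan_scale => _ [z Xz <-]; apply: killed_smadd_cyc.
    by move=> r Ir; rewrite scalerA mulrC -scalerA (Is _ Xz _ Ir) scaler0.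
  by rewrite scalerA mulrC; exact: Is.
rewrite lspan_scale in tbE.
have /choice[g gP] : forall y, exists w, scaleset a X y -> X w /\ a *: w = y.
  move=> y; have [[w Xw <-]|ny] := pselect (scaleset a X y); first by exists w.
  by exists 0.
pose ws := [seq g y | y <- tb].
have tbX y : y \in tb -> scaleset a X y by rewrite tbE; exact: mem_lspan.
have wsX : lspan ws `<=` X.
  by apply: lspan_sub => // _ /mapP[y /tbX ytb ->]; exact: (gP _ ytb).1.
have aws : [seq a *: w | w <- ws] = tb.
  rewrite -map_comp -[RHS]map_id; apply/eq_in_map => y /tbX ytb /=.
  exact: (gP _ ytb).2.
have /choice[f fP] : forall z, exists w, X z -> lspan ws w /\ a *: w = a *: z.
  move=> z; have [Xz|nXz] := pselect (X z); last by exists 0.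
  have : scaleset a X (a *: z) by exists z.
  by rewrite tbE -aws lspan_scale => -[w wsw awz]; exists w.
(* Subtracting from [z] a combination of the lifts with the same image under [a] leaves an element
   killed by [a]. *)
pose us := [seq z - f z | z <- s].
have [|ta [taq taE]] := qP E us unifE.
  apply: lspan_sub; first exact: submodule_killed.
  move=> _ /mapP[z /mem_lspan Xz ->]; have [wsf afz] := fP z Xz.
  apply: killed_smadd_cyc; last by rewrite scalerBr afz subrr.
  by apply: Is; apply: submodB => //; exact: wsX.
exists (ta ++ ws); split; first by rewrite size_cat size_map leq_add.
have suw := submodule_smadd (submodule_lspan us) (submodule_lspan ws).
rewrite lspan_cat -taE; apply/seteqP; split.
  apply: lspan_sub => // z zs; exists (z - f z), (f z); split.
  - by apply: mem_lspan; exact: map_f.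
  - exact: (fP _ (mem_lspan zs)).1.
  - by rewrite subrK.
apply: smadd_sub => //; apply: lspan_sub => // _ /mapP[z /mem_lspan Xz ->].
by apply: submodB => //; apply: wsX; exact: (fP _ Xz).1.
Qed.

Lemma all_gen_bounded m : noetherian R -> local_at m ->
  (krull_dim R <= 1%:Z%:E)%E -> forall I, submodule I -> gen_bounded I.
Proof.
move=> noeth loc dim1; apply: noetherian_devissage => //.
- move=> I sI I1; exists 0%N => E s _ Is; exists [::]; split=> //.
  have s0 := submodule_lspan ([::] : seq E).
  apply/seteqP; split; last by apply: lspan_sub => //; exact: submodule_lspan.
  by move=> z /Is /(_ _ I1); rewrite scale1r => ->; exact: submod0.
- move=> I pI; apply: (prime_gen_bounded noeth loc pI) => J.
  exact: prime_above_eq.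
- move=> I a b sI Ia Ib Iab IH; apply: (split_gen_bounded sI Iab); apply: IH.
  + exact: submodule_smadd (submodule_cyc _).
  + exact: proper_smadd_cyc.
  + exact: submodule_smadd (submodule_cyc _).
  + exact: proper_smadd_cyc.
Qed.

End FiniteLength.

Theorem theorem4p1 (R : comNzRingType) :
  local_ring R -> noetherian R -> (krull_dim R <= 1%:Z%:E)%E ->
  exists n : nat, (0 < n)%N /\
    forall E : lmodType R, indecomposable E -> injective_module E ->
      (malcev_rank E <= n%:Z%:E)%E.
Proof.
move=> loc noeth dim1; have [m locm] := local_ring_at noeth loc.
(* The zero ideal kills every module, so its bound applies to all submodules considered. *)
have [n nP] := all_gen_bounded noeth locm dim1 (submodule_set0 R^o).
(* The successor only ensures positivity, since [n] may be zero. *)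
exists n.+1; split=> // E indE injE; apply/nat_sup_leP => _ [X [sX fgX] <-].
apply/gen_leP => //; have [s Xs] := fgX.
have [|t [tn st]] := nP E s (indecomposable_injective_uniform indE injE).
  by move=> z _ _ ->; rewrite scale0r.
by exists t; split; [exact: leqW|rewrite Xs].
Qed.
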